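(* Let $Y\in\mathbb{R}^n$ satisfy $Y=X\beta+\sigma\xi$ with a deterministic matrix $X\in\mathbb{R}^{n\times p}$ with columns $X_1,\dots,X_p$, $\sigma>0$ and $\xi\sim\mathcal{N}(0,\mathbb{I}_n)$. For any $a>0$, $q\ge1$ and $s<p$, $$\inf_{\hat\beta}\sup_{\beta\in\Omega^p_{s,a}}\mathbf{E}_\beta\big(\|\hat\beta-\beta\|_q^q\big)\ \ge\ \sigma_q^q\max_{S\subseteq\{1,\dots,p\},\,|S|=s}\sum_{i\in S}\frac{1}{\|X_i\|_2^q},$$ where the infimum is over all estimators $\hat\beta$ (measurable functions of $(X,Y)$).
   Context: $\Omega^p_{s,a}=\{\beta\in\mathbb{R}^p:\ |\beta|_0\le s\ \text{and}\ |\beta_i|\ge a\ \forall i\in S_\beta\}$, where $|\beta|_0$ is the number of nonzero entries and $S_\beta$ the set of indices of nonzero entries. $\mathbf{E}_\beta$ is expectation under the model with parameter $\beta$. $\sigma_q:=(\mathbf{E}|\zeta|^q)^{1/q}$ for $\zeta\sim\mathcal{N}(0,\sigma^2)$. $\|\cdot\|_q$ is the $\ell_q$ norm. *)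

(* Defs.v *)
From HB Require Import structures.
From mathcomp Require Import all_boot all_order all_algebra.
From mathcomp Require Import all_classical all_reals all_analysis.
Set Implicit Arguments. Unset Strict Implicit. Unset Printing Implicit Defensive.
Import Order.TTheory GRing.Theory Num.Theory.
Import numFieldNormedType.Exports.
Local Open Scope classical_set_scope.
Local Open Scope ring_scope.

Section defs.
Context {R : realType}.

Definition Omega (p s : nat) (a : R) : set (p.-tuple R) :=
  [set b : p.-tuple R | (#|[set i : 'I_p | tnth b i != 0%R]| <= s)%N /\
           forall i : 'I_p, tnth b i != 0%R -> (a <= `|tnth b i|)%R].

Definition col_norm2 (n p : nat) (X : 'M[R]_(n, p)) (j : 'I_p) : R :=
  Num.sqrt (\sum_(k < n) X k j ^+ 2).

Definition mutually_independent {d} {T : measurableType d}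
  (P : probability T R) (n : nat) (xi : 'I_n -> T -> R) : Prop :=
  forall A : 'I_n -> set R, (forall i, measurable (A i)) ->
    P (\bigcap_(i in [set: 'I_n]) (xi i @^-1` A i)) =
    (\prod_(i < n) P (xi i @^-1` A i))%E.

Definition obs {T : Type} (n p : nat) (X : 'M[R]_(n, p)) (sigma : R)
  (xi : 'I_n -> T -> R) (beta : p.-tuple R) (w : T) : n.-tuple R :=
  [tuple (\sum_(j < p) X i j * tnth beta j) + sigma * xi i w | i < n].

Definition risk {d} {T : measurableType d} (P : probability T R)
  (n p : nat) (X : 'M[R]_(n, p)) (sigma : R) (xi : 'I_n -> T -> R)
  (q : R) (betahat : n.-tuple R -> p.-tuple R) (beta : p.-tuple R) : \bar R :=
  (\int[P]_w (\sum_(i < p)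
      powR `|tnth (betahat (obs X sigma xi beta w)) i - tnth beta i| q)%:E)%E.

Definition sigma_q_q (sigma q : R) : \bar R :=
  (\int[normal_prob 0 sigma]_x (powR `|x| q)%:E)%E.

(* max over S subset {1..p}, |S| = s, of sum_{i in S} 1/||X_i||_2^q
   (with 1/0 = +oo) *)
Definition col_bound (n p s : nat) (X : 'M[R]_(n, p)) (q : R) : \bar R :=
  (\big[maxe/-oo]_(S : {set 'I_p} | #|S| == s)
     \sum_(i in S) ((powR (col_norm2 X i) q)%:E)^-1)%E.

End defs.

(* Main.v *)
(** The coordinates of [beta] on a fixed set [S] are given independent uniform
    priors on [[a, a + M]], the other ones being zero; the average risk over
    this prior is at most the maximal risk.  When all coordinates but the
    [i]-th are frozen, what remains is the location model
    [Y = X_i t + sigma xi] with [t] uniform.  Up to a factor not depending on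
    [t], its likelihood is a normal density in [t] centred at
    [<X_i, Y> / |X_i|^2] with standard deviation [sigma / |X_i|].  Since
    [|.|^q] is convex and this density is symmetric, guessing the centre is
    optimal, at a cost [sigma_q^q / |X_i|^q] up to boundary effects that vanish
    as [M] grows.

    The posterior computation rests on the Cameron-Martin formula
    [E F (xi + c) = E (F xi exp (<c, xi> - |c|^2 / 2))], obtained by shifting
    one coordinate of [xi] at a time. *)

Require Import Defs.
From HB Require Import structures.
From mathcomp Require Import all_boot all_order all_algebra.
From mathcomp Require Import ring lra.
From mathcomp Require Import all_classical all_reals all_analysis measurable_realfun.
Import Order.TTheory GRing.Theory Num.Theory.
Import numFieldNormedType.Exports.
Local Open Scope classical_set_scope.
Local Open Scope ring_scope.

(** * Densities and affine changes of variables *)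

Section density.
Context {d : measure_display} {T : measurableType d} {R : realType}.
Local Open Scope ereal_scope.
Import HBNNSimple.

(** Indicators satisfy the identity by the hypothesis on [m], simple functions by linearity, and
    general [f] by monotone convergence. Only the values of [m] matter, so the lemma serves normal
    laws, restricted measures and tilted probabilities alike. *)
Lemma ge0_integral_density (m mu : {measure set T -> \bar R}) (g : T -> R)
    (f : T -> \bar R) :
  measurable_fun [set: _] g -> (forall x, (0 <= g x)%R) ->
  (forall A, measurable A -> m A = \int[mu]_(x in A) (g x)%:E) ->
  measurable_fun [set: T] f -> (forall x, 0 <= f x) ->
  \int[m]_x f x = \int[mu]_x (f x * (g x)%:E).
Proof.
move=> mg g0 mE mf f0.
have mgE : measurable_fun [set: _] (EFin \o g) by exact/measurable_EFinP.
have g0E x : 0 <= (g x)%:E by rewrite lee_fin.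
pose f_ := nnsfun_approx measurableT mf.
have indE A : measurable A ->
    \int[m]_x (\1_A x)%:E = \int[mu]_x ((\1_A x)%:E * (g x)%:E).
  move=> mA; rewrite integral_indic// setIT mE// integral_mkcond.
  apply: eq_integral => x _; rewrite patchE indicE.
  by case: ifPn; rewrite ?mul1e ?mul0e.
have sfE (h : {nnsfun T >-> R}) :
    \int[m]_x (h x)%:E = \int[mu]_x ((h x)%:E * (g x)%:E).
  under eq_integral do rewrite fimfunE -fsumEFin//.
  rewrite ge0_integral_fsum//; last 2 first.
    - by move=> r; exact/measurable_EFinP/measurableT_comp.
    - by move=> n x _; rewrite EFinM nnfun_muleindic_ge0.
  under [RHS]eq_integral.
    move=> x _; rewrite fimfunE -fsumEFin// ge0_mule_fsuml; last first.
      by move=> r; rewrite EFinM nnfun_muleindic_ge0.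
    over.
  rewrite [RHS]ge0_integral_fsum//; last 2 first.
    - move=> r; apply: emeasurable_funM => //.
      exact/measurable_EFinP/measurableT_comp.
    - by move=> n x _; rewrite mule_ge0// EFinM nnfun_muleindic_ge0.
  apply: eq_fsbigr => r _.
  (* A negative [r] is not a value of [h], so its level set is empty and both sides vanish. *)
  have [r0|r0] := leP 0%R r.
    under eq_integral do rewrite EFinM.
    rewrite ge0_integralZl//; last first.
      exact/measurable_EFinP/measurable_indic.
    rewrite indE//; under [RHS]eq_integral do rewrite EFinM -muleA.
    rewrite ge0_integralZl//.
    - apply: emeasurable_funM => //.
      exact/measurable_EFinP/measurable_indic.
    - by move=> x _; rewrite mule_ge0// lee_fin.
  rewrite preimage_nnfun0//.
  rewrite integral0_eq; last by move=> x _; rewrite indic0 mulr0.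
  by rewrite integral0_eq// => x _; rewrite indic0 mulr0 mul0e.
transitivity (limn (fun n => \int[m]_x (f_ n x)%:E)).
  rewrite -monotone_convergence//=.
  - by apply: eq_integral => x _; apply/esym/cvg_lim => //; exact: cvg_nnsfun_approx.
  - by move=> n; exact/measurable_EFinP/measurable_funTS.
  - by move=> n x _; rewrite lee_fin.
  - by move=> x _ a b ab; rewrite lee_fin; exact/lefP/nd_nnsfun_approx.
under eq_fun do rewrite sfE.
rewrite -monotone_convergence//=.
- apply: eq_integral => x _; apply/cvg_lim => //.
  by apply: cvgeZr => //; exact: cvg_nnsfun_approx.
- move=> n; apply: emeasurable_funM => //.
  exact/measurable_EFinP/measurable_funTS.
- by move=> n x _; rewrite mule_ge0// lee_fin.
- move=> x _ a b ab; apply: lee_wpmul2r => //.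
  by rewrite lee_fin; exact/lefP/nd_nnsfun_approx.
Qed.

(** Provides the exponentially tilted probability used in the Cameron-Martin step. *)
Lemma density_measure_ex (mu : {measure set T -> \bar R}) (g : T -> R) :
  measurable_fun [set: _] g -> (forall x, (0 <= g x)%R) ->
  exists m : {measure set T -> \bar R},
    forall A, m A = \int[mu]_(x in A) (g x)%:E.
Proof.
move=> mg g0; pose f := fun A => \int[mu]_(x in A) (g x)%:E.
have f_0 : f set0 = 0 by rewrite /f integral_set0.
have f_ge0 A : 0 <= f A by apply: integral_ge0 => x _; rewrite lee_fin.
have f_sigma : semi_sigma_additive f.
  apply: semi_sigma_additive_nng_induced; first exact/measurable_EFinP.
  by move=> x; rewrite lee_fin.
pose b := isMeasure.Build _ _ _ f f_0 f_ge0 f_sigma.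
pose M : {measure set T -> \bar R} := HB.pack f b.
by exists M.
Qed.

End density.

Section lebesgue_affine.
Context {R : realType}.
Local Notation leb := (@lebesgue_measure R).
Local Open Scope ereal_scope.

(** The pushforward of Lebesgue measure under $x \mapsto ax+b$, multiplied by $a$, gives each
    interval its length, hence is Lebesgue measure by uniqueness. *)
Lemma ge0_integral_affine (a b : R) (f : R -> \bar R) : (0 < a)%R ->
  measurable_fun [set: R] f -> (forall x, 0 <= f x) ->
  \int[leb]_x f (a * x + b)%R = a^-1%:E * \int[leb]_x f x.
Proof.
move=> a0 mf f0.
pose phi : R -> measurableTypeR R := fun x => (a * x + b)%R.
have mphi : measurable_fun [set: _] phi.
  by apply: measurable_funD => //; exact: measurable_funM.
have ai0 : (0 <= a^-1)%R by rewrite invr_ge0 ltW.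
transitivity (\int[pushforward leb phi]_x f x).
  by rewrite ge0_integral_pushforward// preimage_setT.
rewrite -(ge0_integral_mscale _ _ (NngNum ai0))//.
rewrite (eq_measure_integral (mscale (NngNum ai0) leb))// => A mA _.
have [M ME] : exists M : {measure set (measurableTypeR R) -> \bar R},
    M = pushforward leb phi :> (set _ -> _).
  by unshelve eexists (pushforward leb phi : {measure set _ -> \bar R}).
have E : leb A = mscale (NngNum (ltW a0)) M A.
  apply: lebesgue_measure_unique => // _ [[x y]] _ <-.
  rewrite [RHS](_ : _ = a%:E * M `]x, y]%classic)// ME.
  rewrite /pushforward (_ : phi @^-1` _ = `](a^-1 * (x - b))%R, (a^-1 * (y - b))%R]%classic); last first.
    apply/seteqP; split => z /=; rewrite /phi !in_itv/= => /andP[h1 h2];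
    apply/andP; split.
    - by rewrite mulrC ltr_pdivrMr// mulrC ltrBlDr.
    - by rewrite mulrC ler_pdivlMr// mulrC lerBrDr.
    - by move: h1; rewrite mulrC ltr_pdivrMr// mulrC ltrBlDr.
    - by move: h2; rewrite mulrC ler_pdivlMr// mulrC lerBrDr.
  rewrite !lebesgue_measure_itv/= !lte_fin ltr_pM2l ?invr_gt0// ltrD2r.
  case: ifPn => _; last by rewrite mule0.
  by rewrite -!EFinD -EFinM; congr EFin; field; rewrite gt_eqF.
transitivity (M A); first by rewrite ME.
transitivity (a^-1%:E * leb A); last by [].
by rewrite E [in RHS](_ : mscale _ _ _ = a%:E * M A)// muleA -EFinM mulVf ?mul1e ?gt_eqF.
Qed.

Lemma ge0_integral_oppr (f : R -> \bar R) :
  measurable_fun [set: R] f -> (forall x, 0 <= f x) ->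
  \int[leb]_x f (- x)%R = \int[leb]_x f x.
Proof.
move=> mf f0.
transitivity (\int[pushforward leb (-%R : _ -> measurableTypeR R)]_x f x).
  by rewrite ge0_integral_pushforward// preimage_setT.
by apply: eq_measure_integral => A mA _; exact: lebesgue_measureN.
Qed.

End lebesgue_affine.

Section normal_shift.
Context {R : realType}.
Local Notation leb := (@lebesgue_measure R).
Local Open Scope ereal_scope.

Lemma normal_pdf01E (x : R) :
  normal_pdf 0 1 x = (normal_peak 1 * expR (- x ^+ 2 / 2))%R.
Proof.
by rewrite normal_pdfE ?oner_neq0// /normal_fun subr0 expr1n.
Qed.

(** The one-dimensional Cameron-Martin formula: completing the square turns the tilted density at
    $x$ into the density at $x-c$, and a translation of Lebesgue measure finishes. *)
Lemma normal_prob_shift (c : R) (A : set R) : measurable A ->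
  \int[normal_prob 0 1]_(x in A) (expR (c * x - c ^+ 2 / 2))%:E =
  normal_prob 0 1 [set x | A (x + c)%R].
Proof.
move=> mA.
have mAc : measurable [set x | A (x + c)%R].
  have mc : measurable_fun [set: R] (fun x : R => (x + c)%R).
    exact: measurable_funD.
  by rewrite -[X in measurable X]setTI; exact: mc.
have me : measurable_fun [set: R] (fun x : R => expR (c * x - c ^+ 2 / 2)).
  by apply: measurableT_comp => //; apply: measurable_funB.
have mn := @measurable_normal_pdf R 0 1.
have mi : measurable_fun [set: R] (\1_A : R -> R) by exact: measurable_indic.
pose f x := (\1_A x * normal_pdf 0 1 (x - c))%:E.
have mf : measurable_fun [set: R] f.
  apply/measurable_EFinP; apply: measurable_funM => //.
  by apply: measurableT_comp => //; exact: measurable_funB.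
have f0 x : 0 <= f x by rewrite lee_fin mulr_ge0// normal_pdf_ge0.
transitivity (\int[leb]_x f x).
  rewrite integral_mkcond (@ge0_integral_density _ _ _ _ leb (normal_pdf 0 1))//.
  - apply: eq_integral => x _; rewrite patchE /f indicE.
    case: ifPn => _; last by rewrite mul0e mul0r.
    rewrite mul1r -EFinM !normal_pdf01E mulrCA -expRD; congr ((_ * expR _)%:E).
    by field.
  - exact: normal_pdf_ge0.
  - exact/(measurable_restrictT _ _).1/measurable_EFinP/measurable_funTS.
  - by move=> x; rewrite patchE; case: ifPn => // _; rewrite lee_fin expR_ge0.
(* A translation is the affine substitution of slope $1$; the factor $1^{-1}$ is created to match
   it. *)
rewrite -[LHS]mul1e -[in LHS](@invr1 R) -(@ge0_integral_affine _ 1 c)//.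
rewrite /normal_prob [RHS]integral_mkcond; apply: eq_integral => x _.
rewrite /f mul1r addrK patchE indicE.
have -> : (x \in [set x | A (x + c)%R]) = ((x + c)%R \in A).
  by apply/idP/idP; rewrite !inE.
by case: ifPn => _; rewrite ?mul1r ?mul0r.
Qed.

End normal_shift.

(** * Shifts of a standard normal vector *)

Section rectangles.
Context {R : realType} {n : nat}.

Definition box (A : 'I_n -> set R) : set (n.-tuple R) :=
  [set x | forall i, A i (tnth x i)].

Lemma measurable_box (A : 'I_n -> set R) :
  (forall i, measurable (A i)) -> measurable (box A).
Proof.
move=> mA.
have -> : box A = \big[setI/setT]_(i < n) [set x | A i (tnth x i)].
  by rewrite -bigcap_seq; apply/seteqP; split => x /= h i; [move=> _|];
    apply: h; rewrite /= mem_index_enum.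
apply: bigsetI_measurable => i _.
rewrite -[X in measurable X]setTI.
exact: (@measurable_tnth _ _ n i).
Qed.

(** Boxes are stable under intersection and generate the product sigma-algebra, since a cylinder
    over one coordinate is a box whose other sides are full. The whole space is itself a box, so
    finiteness there suffices for uniqueness. *)
Lemma eq_measure_box (m1 m2 : {measure set (n.-tuple R) -> \bar R}) :
  (m1 setT < +oo)%E ->
  (forall A, (forall i, measurable (A i)) -> m1 (box A) = m2 (box A)) ->
  forall B, measurable B -> m1 B = m2 B.
Proof.
move=> m1oo m12 B mB.
pose G : set (set (n.-tuple R)) :=
  [set C | exists2 A, (forall i, measurable (A i)) & C = box A].
have boxT : box (fun=> setT) = setT by apply/seteqP; split.
apply: (@measure_unique _ _ _ G (fun=> setT)) => //.
- apply/seteqP; split.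
    apply: smallest_sub; first exact: smallest_sigma_algebra.
    rewrite -bigcup_seq; apply: bigcup_sub => i _ _ [A mA <-].
    apply: sub_sigma_algebra; exists (fun j => if j == i then A else setT).
      by move=> j; case: ifPn.
    rewrite setTI; apply/seteqP; split => x /=.
      by move=> Ax j; case: eqVneq => // ->.
    by move=> /(_ i); rewrite eqxx.
  apply: smallest_sub; first exact: sigma_algebra_measurable.
  by move=> _ [A mA ->]; exact: measurable_box.
- move=> _ _ [A mA ->] [A' mA' ->]; exists (fun i => A i `&` A' i).
    by move=> i; exact: measurableI.
  apply/seteqP; split => x /=; first by move=> [h1 h2] i; split.
  by move=> h; split => i; case: (h i).
- by move=> _; exists (fun=> setT).
- by rewrite bigcup_const.
- by move=> _ [A mA ->]; exact: m12.
Qed.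

End rectangles.

(** The source [T] may be a probability space or itself a type of tuples, so that random vectors and
    coordinatewise maps share one measurability lemma. *)
Definition vec_of {T : Type} {R : realType} {n : nat} (f : 'I_n -> T -> R) (w : T) : n.-tuple R :=
  [tuple f i w | i < n].

Lemma measurable_vec_of {d : measure_display} {T : measurableType d}
    {R : realType} {n : nat} (f : 'I_n -> T -> R) :
  (forall i, measurable_fun [set: T] (f i)) ->
  measurable_fun [set: T] (vec_of f).
Proof.
move=> mf; apply/measurable_fun_tnthP => i.
by rewrite (_ : _ \o _ = f i)//; apply/funext => w /=; rewrite tnth_mktuple.
Qed.

Lemma preimage_box {T : Type} {R : realType} {n : nat} (f : 'I_n -> T -> R) A :
  vec_of f @^-1` box A = \bigcap_(i in [set: 'I_n]) (f i @^-1` A i).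
Proof.
by apply/seteqP; split => w /= h i; [move=> _; have := h i|have := h i Logic.I];
  rewrite tnth_mktuple.
Qed.

Lemma ge0_integral_law {R : realType} {d d' : measure_display}
    {T : measurableType d} {U : measurableType d'}
    (P : {measure set T -> \bar R}) (X : T -> U) (m : {measure set U -> \bar R})
    (A : set U) (f : U -> \bar R) :
  measurable_fun [set: T] X ->
  (forall C, measurable C -> m C = P (X @^-1` C)) -> measurable A ->
  measurable_fun A f -> (forall x, A x -> (0 <= f x)%E) ->
  (\int[m]_(x in A) f x = \int[P]_(w in X @^-1` A) f (X w))%E.
Proof.
move=> mX mE mA mf f0.
transitivity (\int[pushforward P X]_(x in A) f x)%E; last first.
  by rewrite ge0_integral_pushforward// => x /[!inE]; exact: f0.
by apply: eq_measure_integral => C mC _; exact: mE.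
Qed.

(** * The Cameron-Martin formula *)

Section gaussian_shift.
Context {R : realType} {d : measure_display} {T : measurableType d}.
Variables (P : probability T R) (n : nat) (xi : 'I_n -> T -> R).
Hypothesis mxi : forall i, measurable_fun [set: T] (xi i).
Hypothesis xi_ind : mutually_independent P xi.
Hypothesis xi_law : forall i (A : set R), measurable A ->
  P (xi i @^-1` A) = normal_prob 0 1 A.
Local Open Scope ereal_scope.

Lemma measurable_preimage_xi i (A : set R) : measurable A ->
  measurable (xi i @^-1` A).
Proof. by move=> mA; rewrite -[X in measurable X]setTI; exact: mxi. Qed.

Let upd (A : 'I_n -> set R) k C : 'I_n -> set R :=
  fun i => if i == k then C else A i.

Lemma prob_box_split (A : 'I_n -> set R) k C :
  (forall i, measurable (A i)) -> measurable C ->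
  P (vec_of xi @^-1` box (upd A k C)) =
  P (vec_of xi @^-1` box (upd A k setT)) * normal_prob 0 1 C.
Proof.
move=> mA mC; rewrite !preimage_box.
rewrite !xi_ind; try by move=> i; rewrite /upd; case: ifPn.
rewrite (bigD1 k)//= [in RHS](bigD1 k)//= /upd eqxx preimage_setT probability_setT.
rewrite mul1e xi_law// muleC; congr *%E.
by apply: eq_bigr => i /negbTE ->.
Qed.

(** The event [B] constrains only the coordinates other than [k]. By independence, the law of [xi k]
    under [P] restricted to [B] is therefore the standard normal law scaled by [P B]. *)
Lemma integral_box_split (A : 'I_n -> set R) k (g : R -> R) :
  (forall i, measurable (A i)) ->
  measurable_fun [set: R] g -> (forall x, (0 <= g x)%R) ->
  \int[P]_(w in vec_of xi @^-1` box A) (g (xi k w))%:E =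
  P (vec_of xi @^-1` box (upd A k setT)) *
    \int[normal_prob 0 1]_(x in A k) (g x)%:E.
Proof.
move=> mA mg g0; set B := vec_of xi @^-1` box (upd A k setT).
have mB : measurable B.
  rewrite -[B]setTI; apply: (measurable_vec_of _ mxi measurableT).
  by apply: measurable_box => i; rewrite /upd; case: ifPn.
have p0 : (0 <= fine (P B))%R by rewrite fine_ge0.
have -> : P B = (NngNum p0)%:num%:E by rewrite /= fineK// fin_num_measure.
have mgE : measurable_fun [set: R] (EFin \o g) by exact/measurable_EFinP.
rewrite -ge0_integral_mscale; last 3 first.
- exact: mA.
- exact: measurable_funTS.
- by move=> x _; rewrite lee_fin.
rewrite (ge0_integral_law (mrestr P mB)
  (xi k : T -> measurableTypeR R)); last 5 first.
- exact: mxi.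
- move=> C mC.
  transitivity ((fine (P B))%:E * normal_prob 0 1 C); first by [].
  rewrite fineK ?fin_num_measure// -prob_box_split//; congr (P _); apply/seteqP; split => w /=.
    move=> h; split; first by have := h k; rewrite /upd eqxx tnth_mktuple.
    by move=> i; have := h i; rewrite /upd; case: ifPn.
  by move=> [h1 h2] i; have := h2 i; rewrite /upd tnth_mktuple;
    case: eqVneq => // ->.
- exact: mA.
- exact: measurable_funTS.
- by move=> x _; rewrite lee_fin.
have mk : measurable (xi k @^-1` A k) by exact: measurable_preimage_xi.
have mgx : measurable_fun [set: T] (fun w => (g (xi k w))%:E).
  by apply/measurable_EFinP; exact: measurableT_comp.
rewrite [RHS]integral_mkcond/=.
rewrite (@ge0_integral_density _ _ _ _ P (\1_B))//.
- rewrite [LHS]integral_mkcond; apply: eq_integral => w _.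
  rewrite !patchE indicE.
  have -> : (w \in vec_of xi @^-1` box A) = (w \in xi k @^-1` A k) && (w \in B).
    apply/idP/andP; rewrite !inE /=.
      move=> h; split; first by have := h k; rewrite tnth_mktuple.
      by move=> i; have := h i; rewrite /upd; case: ifPn.
    move=> [h1 h2] i; have := h2 i; rewrite /upd.
    by case: eqVneq => // -> _; rewrite tnth_mktuple.
  by case: (_ \in xi k @^-1` _); case: (w \in B) => /=; rewrite ?(mule1, mule0).
- by move=> C mC; rewrite integral_indic// setIC.
- exact/(measurable_restrictT _ _).1/measurable_funTS.
- by move=> x; rewrite patchE; case: ifPn => // _; rewrite lee_fin.
Qed.

(** Both sides integrate [F]: against the law of the shifted vector under [P], and against the law
    of the original vector under a tilted measure [Q]. On a box both laws factor, and the factors at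
    [k] agree by [normal_prob_shift]. *)
Lemma gaussian_shift1 k (c : R) (F : n.-tuple R -> \bar R) :
  measurable_fun [set: n.-tuple R] F -> (forall x, 0 <= F x) ->
  \int[P]_w F (vec_of (fun i w => xi i w + if i == k then c else 0)%R w) =
  \int[P]_w (F (vec_of xi w) * (expR (c * xi k w - c ^+ 2 / 2))%:E).
Proof.
move=> mF F0; pose xi' (i : 'I_n) w := (xi i w + if i == k then c else 0)%R.
have mxi' i : measurable_fun [set: T] (xi' i).
  by apply: measurable_funD => //; exact: mxi.
pose e (x : R) := expR (c * x - c ^+ 2 / 2).
have me : measurable_fun [set: R] e.
  by apply: measurableT_comp => //; apply: measurable_funB.
have e0 x : (0 <= e x)%R by exact: expR_ge0.
have mek : measurable_fun [set: T] (e \o xi k) by exact: measurableT_comp.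
have [Q QE] := density_measure_ex P _ mek (fun w => e0 (xi k w)).
rewrite -(@ge0_integral_density _ _ _ Q P (e \o xi k))//; last 2 first.
  by move=> w; exact: e0.
  by apply: measurableT_comp => //; exact: measurable_vec_of.
have mv := measurable_vec_of _ mxi; have mv' := measurable_vec_of _ mxi'.
transitivity (\int[pushforward P (vec_of xi')]_x F x).
  by rewrite ge0_integral_pushforward// preimage_setT.
transitivity (\int[pushforward Q (vec_of xi)]_x F x); last first.
  by rewrite ge0_integral_pushforward// preimage_setT.
apply: eq_measure_integral => A mA _.
apply: eq_measure_box => //.
  rewrite /= /pushforward preimage_setT; apply: (le_lt_trans (probability_le1 _ _)) => //.
  exact: ltry.
move=> {mA}{}A mA.
transitivity (P (vec_of xi @^-1` box (upd A k [set x | A k (x + c)%R]))).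
  congr (P _); apply/seteqP; split => w /= h i; have := h i;
    rewrite /upd !tnth_mktuple /xi'; case: eqVneq => [->|] //=; by rewrite addr0.
have mAk : measurable [set x | A k (x + c)%R].
  have mc : measurable_fun [set: R] (fun x : R => (x + c)%R).
    exact: measurable_funD.
  by rewrite -[X in measurable X]setTI; exact: mc.
transitivity (Q (vec_of xi @^-1` box A)); last by [].
by rewrite prob_box_split// -normal_prob_shift// QE integral_box_split.
Qed.

(** Induction on the list of coordinates already shifted, with [F] generalised because each step
    changes the integrand. *)
Lemma gaussian_shift (c : 'I_n -> R) (F : n.-tuple R -> \bar R) :
  measurable_fun [set: n.-tuple R] F -> (forall x, 0 <= F x) ->
  \int[P]_w F (vec_of (fun i w => xi i w + c i)%R w) =
  \int[P]_w (F (vec_of xi w) *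
              (expR (\sum_i (c i * xi i w - c i ^+ 2 / 2)))%:E).
Proof.
pose e i (x : R) := expR (c i * x - c i ^+ 2 / 2).
have me i : measurable_fun [set: R] (e i).
  by apply: measurableT_comp => //; apply: measurable_funB.
suff H (l : seq 'I_n) : uniq l -> forall F : n.-tuple R -> \bar R,
    measurable_fun [set: n.-tuple R] F -> (forall x, 0 <= F x) ->
    \int[P]_w F (vec_of (fun i w => xi i w + if i \in l then c i else 0)%R w) =
    \int[P]_w (F (vec_of xi w) *
                (expR (\sum_(i <- l) (c i * xi i w - c i ^+ 2 / 2)))%:E).
  move=> mF F0; rewrite -(H _ (index_enum_uniq _))//.
  apply: eq_integral => w _; congr F; apply: eq_from_tnth => i.
  by rewrite !tnth_mktuple mem_index_enum.
elim: l => [_ {}F mF F0|k l IH /= /andP[kl ul] {}F mF F0].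
  apply: eq_integral => w _; rewrite big_nil expR0 mule1; congr F.
  by apply: eq_from_tnth => i; rewrite !tnth_mktuple addr0.
pose sh (x : n.-tuple R) : n.-tuple R :=
  vec_of (fun i x => tnth x i + if i \in l then c i else 0)%R x.
have msh : measurable_fun [set: n.-tuple R] sh.
  apply: measurable_vec_of => i; apply: measurable_funD => //.
  exact: measurable_tnth.
have mFk : measurable_fun [set: n.-tuple R] (fun x => F x * (e k (tnth x k))%:E).
  apply: emeasurable_funM => //; apply/measurable_EFinP.
  apply: measurableT_comp => //; exact: measurable_tnth.
have Fk0 x : 0 <= F x * (e k (tnth x k))%:E.
  by rewrite mule_ge0// lee_fin expR_ge0.
(* Coordinate [k] is shifted first, with the shift [sh] along [l] absorbed into the integrand. *)
transitivity (\int[P]_w (F (sh (vec_of xi w)) * (e k (xi k w))%:E)).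
  rewrite -(gaussian_shift1 k (c k) (F \o sh)) => [|| x]; last 2 first.
    exact: measurableT_comp.
    exact: F0.
  apply: eq_integral => w _; congr F; apply: eq_from_tnth => i.
  rewrite !tnth_mktuple inE; case: eqVneq => [->|ik] /=.
    by rewrite (negbTE kl) addr0.
  by rewrite addr0.
(* The induction hypothesis is applied to [F] times the exponential weight of coordinate [k]; since
   [k] is not in [l], the shift leaves this weight unchanged. *)
transitivity (\int[P]_w (F (vec_of xi w) * (e k (tnth (vec_of xi w) k))%:E *
    (expR (\sum_(i <- l) (c i * xi i w - c i ^+ 2 / 2)))%:E)).
  rewrite -(IH ul _ mFk Fk0); apply: eq_integral => w _.
  congr (F _ * _).
    by apply: eq_from_tnth => i; rewrite !tnth_mktuple.
  by rewrite !tnth_mktuple (negbTE kl) addr0.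
apply: eq_integral => w _; rewrite big_cons expRD EFinM -muleA; congr (_ * (_ * _)).
by rewrite tnth_mktuple.
Qed.

End gaussian_shift.

(** * The Bayes risk in a location model *)

Section symmetric_weight.
Context {R : realType}.
Local Notation leb := (@lebesgue_measure R).

(** Convexity of $x^q$ on the nonnegative reals, as $u$ is half the difference of $c+u$ and
    $c-u$. *)
Lemma powR_abs_midpoint (q c u : R) : 1 <= q ->
  2 * `|u| `^ q <= `|c - u| `^ q + `|c + u| `^ q.
Proof.
move=> q1; have q0 : 0 <= q by apply: le_trans q1.
have h : `|u| <= 2^-1 * `|c - u| + 2^-1 * `|c + u|.
  have {1}-> : u = 2^-1 * ((c + u) - (c - u)) by field.
  rewrite normrM ger0_norm ?invr_ge0// -mulrDr ler_pM2l ?invr_gt0//.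
  by rewrite [leRHS]addrC; exact: ler_normB.
have h2 : `|u| `^ q <= 2^-1 * `|c - u| `^ q + 2^-1 * `|c + u| `^ q.
  apply: (@le_trans _ _ ((2^-1 * `|c - u| + 2^-1 * `|c + u|) `^ q)).
    by apply: ge0_ler_powR => //; rewrite nnegrE// addr_ge0// mulr_ge0.
  (* The second weight is written as one minus the first, the form in which convexity is stated. *)
  rewrite {2 4}(_ : 2^-1 = 1 - 2^-1 :> R); last by field.
  by apply: (convex_powR q1 (Itv01 _ _)) => //=;
    rewrite ?inE/= ?in_itv/= ?normr_ge0// ?invr_ge0// invf_le1 ?ler1n.
have : 2 * `|u| `^ q <= 2 * (2^-1 * `|c - u| `^ q + 2^-1 * `|c + u| `^ q).
  by rewrite ler_pM2l.
by rewrite mulrDr !mulrA mulfV// !mul1r.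
Qed.

Lemma measurable_powR_dist (q c : R) :
  measurable_fun [set: R] (fun t : R => `|c - t| `^ q).
Proof.
apply: (measurableT_comp (measurable_powR q)); apply: measurableT_comp => //.
exact: measurable_funB.
Qed.

(** As [psi] is even, reflecting $u$ shows that the centres $c$ and $-c$ cost the same; by the
    midpoint inequality their sum is at least twice the cost of the centre $0$. *)
Lemma ge0_integral_even_powR_min (q c : R) (psi : R -> R) : 1 <= q ->
  measurable_fun [set: R] psi -> (forall x, 0 <= psi x) ->
  (forall x, psi (- x) = psi x) ->
  (\int[leb]_u (`|u| `^ q * psi u)%:E <=
   \int[leb]_u (`|c - u| `^ q * psi u)%:E)%E.
Proof.
move=> q1 mpsi psi0 psiN.
have mc c' : measurable_fun [set: R] (fun u => (`|c' - u| `^ q * psi u)%:E).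
  apply/measurable_EFinP; apply: measurable_funM => //.
  exact: measurable_powR_dist.
have c0 c' u : (0 <= (`|c' - u| `^ q * psi u)%:E)%E.
  by rewrite lee_fin mulr_ge0// powR_ge0.
have E0 : (\int[leb]_u (`|u| `^ q * psi u)%:E =
           \int[leb]_u (`|0 - u| `^ q * psi u)%:E)%E.
  by apply: eq_integral => u _; rewrite sub0r normrN.
have EN : (\int[leb]_u (`|c - u| `^ q * psi u)%:E =
           \int[leb]_u (`|- c - u| `^ q * psi u)%:E)%E.
  rewrite -(@ge0_integral_oppr _ _ (mc c) (c0 c)).
  by apply: eq_integral => u _; rewrite psiN opprK -normrN opprD.
(* Adding the supposed strict inequality to itself gives the doubled form without halving in the
   extended reals. *)
rewrite leNgt; apply/negP => lt.
have := lteD lt lt; apply/negP; rewrite -leNgt.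
pose f c' (u : R) := (`|c' - u| `^ q * psi u)%:E.
have fD c1 c2 : (\int[leb]_u (f c1 u + f c2 u) =
    \int[leb]_u f c1 u + \int[leb]_u f c2 u)%E.
  apply: ge0_integralD.
  - exact: measurableT.
  - by move=> u _; exact: c0.
  - exact: mc.
  - by move=> u _; exact: c0.
  - exact: mc.
have fcc := etrans (fD c (- c)) (congr1 (fun z => \int[leb]_u f c u + z)%E (esym EN)).
suff H : (\int[leb]_u (f 0%R u + f 0%R u) <= \int[leb]_u (f c u + f (- c)%R u))%E.
  by rewrite E0; move: H; rewrite fcc (fD 0 0) /f; exact.
apply: ge0_le_integral.
- exact: measurableT.
- by move=> u _; apply: adde_ge0; exact: c0.
- by apply: emeasurable_funD; exact: mc.
- by apply: emeasurable_funD; exact: mc.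
- move=> u _; rewrite /f -!EFinD lee_fin -2!mulrDl.
  apply: (ler_wpM2r (psi0 u)); have := powR_abs_midpoint q c u q1.
  by rewrite sub0r normrN -(normrN (c + u)) opprD mulr_natl mulr2n.
Qed.

(** The substitution $x = b(t-m)$ turns $|h-t|^q$ into $|c-x|^q/b^q$ with $c = b(h-m)$, which
    reduces to the centred case. *)
Lemma ge0_integral_recentred_powR_min (q b h m : R) (psi : R -> R) :
  1 <= q -> 0 < b ->
  measurable_fun [set: R] psi -> (forall x, 0 <= psi x) ->
  (forall x, psi (- x) = psi x) ->
  (((b `^ q)^-1)%:E * \int[leb]_x (`|x| `^ q * psi x)%:E <=
   \int[leb]_t (`|h - t| `^ q * (b * psi (b * (t - m))))%:E)%E.
Proof.
move=> q1 b0 mpsi psi0 psiN.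
pose c := b * (h - m).
pose f x := (`|c - x| `^ q * psi x)%:E.
have mf : measurable_fun [set: R] f.
  by apply/measurable_EFinP; apply: measurable_funM => //; exact: measurable_powR_dist.
have f0 x : (0 <= f x)%E by rewrite lee_fin mulr_ge0// powR_ge0.
have bq0 : 0 <= (b `^ q)^-1 by rewrite invr_ge0 powR_ge0.
have -> : (\int[leb]_t (`|h - t| `^ q * (b * psi (b * (t - m))))%:E =
    ((b `^ q)^-1)%:E * \int[leb]_x f x)%E.
  have -> : (\int[leb]_x f x = b%:E * \int[leb]_t f (b * t + - (b * m))%R)%E.
    by rewrite ge0_integral_affine// muleA -EFinM mulfV ?mul1e// gt_eqF.
  rewrite muleA -EFinM -ge0_integralZl//; last 2 first.
    by apply: measurableT_comp => //; apply: measurable_funD.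
    by rewrite lee_fin mulr_ge0// ltW.
  apply: eq_integral => t _; rewrite -EFinM; congr EFin.
  rewrite -mulrBr /c (_ : b * (h - m) - b * (t - m) = b * (h - t)); last by ring.
  rewrite normrM (ger0_norm (ltW b0)) powRM// ?(ltW b0)//.
  by field; rewrite gt_eqF// powR_gt0.
apply: lee_wpmul2l; first by rewrite lee_fin.
exact: ge0_integral_even_powR_min.
Qed.

End symmetric_weight.

Lemma ge0_integralZl_real {d : measure_display} {T : measurableType d}
    {R : realType} (mu : {measure set T -> \bar R}) (k : R) (f : T -> R) :
  measurable_fun [set: T] f -> (forall x, 0 <= f x) -> 0 <= k ->
  (\int[mu]_x (k * f x)%:E = k%:E * \int[mu]_x (f x)%:E)%E.
Proof.
move=> mf f0 k0; under eq_integral do rewrite EFinM.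
rewrite ge0_integralZl//; first exact/measurable_EFinP.
by move=> x _; rewrite lee_fin.
Qed.

(** * Posterior and Bayes risk for one unknown coordinate *)

Section location_model.
Context {R : realType} {d : measure_display} {T : measurableType d}.
Variables (P : probability T R) (n : nat) (xi : 'I_n -> T -> R).
Hypothesis mxi : forall i, measurable_fun [set: T] (xi i).
Hypothesis xi_ind : mutually_independent P xi.
Hypothesis xi_law : forall i (A : set R), measurable A ->
  P (xi i @^-1` A) = normal_prob 0 1 A.
Variables (sigma b : R) (v : 'I_n -> R).
Hypotheses (sigma0 : 0 < sigma) (b0 : 0 < b).
Hypothesis bE : b ^+ 2 = \sum_k v k ^+ 2.
Local Notation leb := (@lebesgue_measure R).

(** The least-squares estimate of $t$ from the observation $\sigma x$; tuples here are observations
    divided by $\sigma$. *)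
Let center (x : n.-tuple R) : R :=
  sigma * (\sum_k v k * tnth x k) / b ^+ 2.

(** The factor of the likelihood ratio free of $t$. It is also the marginal density of $x$, relative
    to the law of the noise, under a Lebesgue prior on $t$. *)
Let dens (x : n.-tuple R) : R :=
  expR (center x ^+ 2 * b ^+ 2 / (2 * sigma ^+ 2)) / (b * normal_peak sigma).

(** The posterior density of $t$ under a Lebesgue prior. *)
Let pdf (t : R) (x : n.-tuple R) : R :=
  b * normal_pdf 0 sigma (b * (t - center x)).

Let shifted (t : R) : T -> n.-tuple R :=
  vec_of (fun i w => xi i w + v i * t / sigma).

(* The likelihood ratio between the means [v t / sigma] and [0], as a function
   of [t], is a normal density centred at [center x]. *)
Let weightE t x :
  expR (\sum_k (v k * t / sigma * tnth x k - (v k * t / sigma) ^+ 2 / 2)) =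
  dens x * pdf t x.
Proof.
have peak0 : normal_peak sigma != 0 by rewrite gt_eqF// normal_peak_gt0// gt_eqF.
have bn0 : b != 0 by rewrite gt_eqF.
have sn0 : sigma != 0 by rewrite gt_eqF.
rewrite /dens /pdf normal_pdfE// /normal_fun subr0.
rewrite [RHS](_ : _ = expR (center x ^+ 2 * b ^+ 2 / (2 * sigma ^+ 2)) *
  expR (- (b * (t - center x)) ^+ 2 / (sigma ^+ 2 *+ 2))); last first.
  set e1 := expR _; set e2 := expR _; move: (normal_peak sigma) peak0 => k k0.
  by field; rewrite k0 bn0.
rewrite -expRD; congr expR.
have E1 : \sum_k v k * t / sigma * tnth x k = t / sigma * \sum_k v k * tnth x k.
  by rewrite mulr_sumr; apply: eq_bigr => k _; ring.
have E2 : \sum_k (v k * t / sigma) ^+ 2 / 2 = t ^+ 2 / sigma ^+ 2 / 2 * b ^+ 2.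
  by rewrite bE mulr_sumr; apply: eq_bigr => k _; field.
rewrite big_split/= sumrN E1 E2 /center; set S := \sum_k _.
by rewrite -mulr_natl; field; rewrite sn0 bn0.
Qed.

Let centerD t w : center (shifted t w) = center (vec_of xi w) + t.
Proof.
have bn0 : b != 0 by rewrite gt_eqF.
have sn0 : sigma != 0 by rewrite gt_eqF.
have E : \sum_k v k * tnth (shifted t w) k =
    \sum_k v k * tnth (vec_of xi w) k + t / sigma * b ^+ 2.
  rewrite bE mulr_sumr -big_split /=; apply: eq_bigr => k _.
  by rewrite !tnth_mktuple; field.
rewrite /center E; set S := \sum_k _.
by field; rewrite bn0 sn0.
Qed.

Let mcenter : measurable_fun [set: n.-tuple R] center.
Proof.
apply: measurable_funM => //; apply: measurable_funM => //.
apply: measurable_sum => k; apply: measurable_funM => //.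
exact: measurable_tnth.
Qed.

Let mdens : measurable_fun [set: n.-tuple R] dens.
Proof.
apply: measurable_funM => //; apply: measurableT_comp => //.
apply: measurable_funM => //; apply: measurable_funM => //.
exact: measurable_funX.
Qed.

Let dens0 x : 0 <= dens x.
Proof. by rewrite divr_ge0 ?expR_ge0// mulr_ge0 ?normal_peak_ge0// ltW. Qed.

Let pdf0 t x : 0 <= pdf t x.
Proof. by rewrite mulr_ge0 ?normal_pdf_ge0// ltW. Qed.

Let mpdf : measurable_fun [set: R * n.-tuple R] (fun z => pdf z.1 z.2).
Proof.
apply: measurable_funM => //.
apply: (measurableT_comp (measurable_normal_pdf 0 sigma)).
apply: measurable_funM => //; apply: measurable_funB => //.
exact: (measurableT_comp mcenter).
Qed.

Let tonelli (G : R * n.-tuple R -> \bar R) :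
  measurable_fun [set: R * n.-tuple R] G -> (forall z, (0 <= G z)%E) ->
  (\int[leb]_t \int[P]_w G (t, vec_of xi w) =
   \int[P]_w \int[leb]_t G (t, vec_of xi w))%E.
Proof.
move=> mG G0.
pose G' (z : R * T) := G (z.1, vec_of xi z.2).
apply: (@fubini_tonelli _ _ _ _ _ leb P G') => [|z]; last exact: G0.
apply: measurableT_comp => //; apply: measurable_fun_pair => //.
exact: (measurableT_comp (measurable_vec_of _ mxi)).
Qed.

Let shiftE t (F : n.-tuple R -> R) :
  measurable_fun [set: n.-tuple R] F -> (forall x, 0 <= F x) ->
  (\int[P]_w (F (shifted t w))%:E =
   \int[P]_w (F (vec_of xi w) * (dens (vec_of xi w) * pdf t (vec_of xi w)))%:E)%E.
Proof.
move=> mF F0.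
rewrite (@gaussian_shift _ _ _ P _ xi mxi xi_ind xi_law
  (fun i => v i * t / sigma) (EFin \o F)); last 2 first.
  exact/measurable_EFinP.
  by move=> x; rewrite lee_fin.
apply: eq_integral => w _; rewrite -weightE -EFinM; congr (_ * expR _)%:E.
by apply: eq_bigr => k _; rewrite tnth_mktuple.
Qed.

Let mslice (F : R -> n.-tuple R -> R) t :
  measurable_fun [set: R * n.-tuple R] (fun z => F z.1 z.2) ->
  measurable_fun [set: n.-tuple R] (F t).
Proof.
by move=> mF; exact: (measurableT_comp mF (pair1_measurable t)).
Qed.

(** Cameron-Martin moves the parameter from the observation into the likelihood; after the exchange,
    the inner integral is a posterior average at a fixed observation. *)
Let shift_tonelli (F : R -> n.-tuple R -> R) :
  measurable_fun [set: R * n.-tuple R] (fun z => F z.1 z.2) ->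
  (forall t x, 0 <= F t x) ->
  (\int[leb]_t \int[P]_w (F t (shifted t w))%:E =
   \int[P]_w \int[leb]_t (F t (vec_of xi w) *
     (dens (vec_of xi w) * pdf t (vec_of xi w)))%:E)%E.
Proof.
move=> mF F0.
under eq_integral do (rewrite shiftE//; last exact: mslice).
pose G (z : R * n.-tuple R) := (F z.1 z.2 * (dens z.2 * pdf z.1 z.2))%:E.
rewrite (tonelli G)//.
  apply/measurable_EFinP; apply: measurable_funM => //.
  by apply: measurable_funM => //; exact: (measurableT_comp mdens).
by move=> z; rewrite lee_fin mulr_ge0// mulr_ge0.
Qed.

Let integral_pdf x : (\int[leb]_t (pdf t x)%:E = 1)%E.
Proof.
have mn : measurable_fun [set: R] (fun y => (normal_pdf 0 sigma y)%:E).
  by apply/measurable_EFinP; exact: measurable_normal_pdf.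
rewrite -(integral_normal_pdf 0 sigma).
transitivity (b%:E * \int[leb]_t (normal_pdf 0 sigma (b * t + - (b * center x)))%:E)%E.
  rewrite -(ge0_integralZl_real leb b
    (fun t => normal_pdf 0 sigma (b * t + - (b * center x)))).
  - by apply: eq_integral => t _; rewrite /pdf mulrBr.
  - apply: (measurableT_comp (measurable_normal_pdf 0 sigma)).
    by apply: measurable_funD => //; exact: measurable_funM.
  - by move=> t; exact: normal_pdf_ge0.
  - exact: ltW.
rewrite (@ge0_integral_affine _ _ _ (fun y => (normal_pdf 0 sigma y)%:E))//.
  by rewrite muleA -EFinM mulfV ?mul1e// gt_eqF.
by move=> y; rewrite lee_fin normal_pdf_ge0.
Qed.

(** Under a Lebesgue prior the centre is itself Lebesgue distributed: inserting $\int$ [pdf] $= 1$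
    and undoing the shift replaces the centre by the centre plus $t$, and integrating over $t$ first
    gives the length of the interval. *)
Let integral_dens (u1 u2 : R) : u1 <= u2 ->
  (\int[P]_w (\1_`[u1, u2] (center (vec_of xi w)) * dens (vec_of xi w))%:E =
   (u2 - u1)%:E)%E.
Proof.
move=> u12; pose J := `[u1, u2]%classic.
have mJ : measurable_fun [set: R] (\1_J : R -> R).
  by apply: measurable_indic; exact: measurable_itv.
have mJc : measurable_fun [set: R * n.-tuple R] (fun z => \1_J (center z.2) : R).
  apply: (measurableT_comp mJ); exact: (measurableT_comp mcenter).
transitivity (\int[P]_w \int[leb]_t (\1_J (center (vec_of xi w)) *
     (dens (vec_of xi w) * pdf t (vec_of xi w)))%:E)%E.
  apply: eq_integral => w _; set x := vec_of xi w.
  under eq_integral do rewrite mulrA.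
  rewrite (ge0_integralZl_real leb (\1_J (center x) * dens x) (pdf ^~ x)).
  - by rewrite integral_pdf mule1.
  - exact: (measurableT_comp mpdf (pair2_measurable x)).
  - by move=> t; exact: pdf0.
  - by rewrite mulr_ge0// indicE.
rewrite -(shift_tonelli (fun t x => \1_J (center x)) mJc); last first.
  by move=> t x; rewrite indicE.
under eq_integral do under eq_integral do rewrite centerD.
pose G (z : R * n.-tuple R) := (\1_J (center z.2 + z.1))%:E : \bar R.
rewrite (tonelli G); last 2 first.
- apply/measurable_EFinP; apply: (measurableT_comp mJ).
  by apply: measurable_funD => //; exact: (measurableT_comp mcenter).
- by move=> z; rewrite lee_fin indicE.
rewrite (eq_integral (cst (u2 - u1)%:E)).
  rewrite integral_cst// -[RHS]mule1; congr (_ * _)%E.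
  exact: probability_setT.
move=> w _; set x := vec_of xi w.
transitivity (\int[leb]_t (\1_J (1 * t + center x))%:E : \bar R)%E.
  by apply: eq_integral => t _; rewrite mul1r /G addrC.
have mJE : measurable_fun [set: R] (fun y => (\1_J y)%:E : \bar R).
  exact/measurable_EFinP.
have J0E y : (0 <= (\1_J y)%:E :> \bar R)%E by rewrite lee_fin indicE.
rewrite (@ge0_integral_affine _ 1 _ _ ltr01 mJE J0E).
rewrite invr1 mul1e; transitivity (leb J).
  rewrite integral_indic; [|exact: measurableT|exact: measurable_itv].
  by congr (leb _); exact: setIT.
rewrite lebesgue_measure_itv/= lte_fin.
case: ltP => [_|u21]; first by rewrite EFinB.
by have -> : u2 = u1 by [apply/le_anti/andP]; rewrite subrr.
Qed.

(** The noise density truncated to a symmetric window: it stays even, and it confines $t$ to a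
    bounded neighbourhood of the centre. *)
Let psi (K x : R) : R := \1_`[- K, K] x * normal_pdf 0 sigma x.

(** At a fixed observation the truncated posterior cost is least at the centre, whatever the
    estimator [h]. Integrating over observations whose centre stays at distance $K/b$ from both ends
    of $[A,B]$ yields the factor $B-A-2K/b$. *)
Lemma bayes_risk_location (q A B K : R) (h : n.-tuple R -> R) :
  1 <= q -> measurable_fun [set: n.-tuple R] h -> 0 <= K ->
  A + 2 * (K / b) <= B ->
  (((b `^ q)^-1)%:E *
     (\int[leb]_x (`|x| `^ q * (\1_`[- K, K] x * normal_pdf 0 sigma x))%:E) *
     (B - A - 2 * (K / b))%:E <=
   \int[leb]_(t in `[A, B]) \int[P]_w
     (`|h (vec_of (fun k w => v k * t + sigma * xi k w)%R w) - t| `^ q)%:E)%E.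
Proof.
move=> q1 mh K0 AB; have sn0 : sigma != 0 by rewrite gt_eqF.
pose L := K / b; pose u1 := A + L; pose u2 := B - L.
have L0 : 0 <= L by rewrite divr_ge0// ltW.
have u12 : u1 <= u2 by rewrite /u1 /u2 /L; lra.
pose J := `[u1, u2]%classic; pose I := `[- K, K]%classic.
have mJ : measurable_fun [set: R] (\1_J : R -> R).
  by apply: measurable_indic; exact: measurable_itv.
have mI : measurable_fun [set: R] (\1_I : R -> R).
  by apply: measurable_indic; exact: measurable_itv.
(* Converts tuples in units of the noise back to the observations that [h] receives. *)
pose sc (x : n.-tuple R) : n.-tuple R := vec_of (fun k y => sigma * tnth y k) x.
have msc : measurable_fun [set: n.-tuple R] sc.
  apply: measurable_vec_of => k; apply: measurable_funM => //.
  exact: measurable_tnth.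
pose F t x : R := `|h (sc x) - t| `^ q *
  (\1_J (center x) * \1_I (b * (t - center x))).
have mpow : measurable_fun [set: R * n.-tuple R] (fun z => `|h (sc z.2) - z.1| `^ q).
  apply: (measurableT_comp (measurable_powR q)); apply: measurableT_comp => //.
  apply: measurable_funB => //; apply: (measurableT_comp mh).
  exact: (measurableT_comp msc).
have mF : measurable_fun [set: R * n.-tuple R] (fun z => F z.1 z.2).
  apply: measurable_funM => //; apply: measurable_funM.
    apply: (measurableT_comp mJ); exact: (measurableT_comp mcenter).
  apply: (measurableT_comp mI); apply: measurable_funM => //.
  apply: measurable_funB => //; exact: (measurableT_comp mcenter).
have F0 t x : 0 <= F t x by rewrite mulr_ge0 ?powR_ge0// !indicE mulr_ge0.
set C := (((b `^ q)^-1)%:E * _)%E.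
have C0 : (0 <= C)%E.
  apply: mule_ge0; first by rewrite lee_fin invr_ge0 powR_ge0.
  apply: integral_ge0 => x _.
  by rewrite lee_fin mulr_ge0 ?powR_ge0// indicE mulr_ge0// normal_pdf_ge0.
have scE t w : sc (shifted t w) = vec_of (fun k w => v k * t + sigma * xi k w) w.
  by apply: eq_from_tnth => k; rewrite !tnth_mktuple; field.
have mshift t : measurable_fun [set: T] (shifted t).
  apply: measurable_vec_of => k; exact: measurable_funD.
have mshift2 : measurable_fun [set: R * T] (fun z => (z.1, shifted z.1 z.2)).
  apply: measurable_fun_pair => //.
  apply: (measurable_vec_of (fun k (z : R * T) => xi k z.2 + v k * z.1 / sigma)) => k.
  apply: measurable_funD; first exact: (measurableT_comp (mxi k)).
  by apply: measurable_funM => //; exact: measurable_funM.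
have mJc : measurable_fun [set: n.-tuple R] (fun x => \1_J (center x) * dens x : R).
  by apply: measurable_funM => //; exact: (measurableT_comp mJ).
have JD0 x : (0 <= (\1_J (center x) * dens x)%:E)%E.
  by rewrite lee_fin mulr_ge0// indicE.
have mpsi : measurable_fun [set: R] (psi K).
  by apply: measurable_funM => //; exact: measurable_normal_pdf.
have psi0 x : 0 <= psi K x by rewrite mulr_ge0 ?normal_pdf_ge0// indicE.
have psiN x : psi K (- x) = psi K x.
  rewrite /psi !indicE !normal_pdfE// /normal_fun !subr0 sqrrN.
  suff -> : (- x \in `[- K, K]%classic) = (x \in `[- K, K]%classic) by [].
  by apply/idP/idP; rewrite !inE /= !in_itv/= => /andP[? ?];
    apply/andP; split; lra.
(* Keep only the event where the posterior window of half-width [L] around the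
   centre lies inside the prior interval; it forces [t] into that interval, so
   that [t] can then range over the whole line. *)
apply: (@le_trans _ _ (\int[leb]_t \int[P]_w (F t (shifted t w))%:E)%E); last first.
  rewrite [leRHS]integral_mkcond; apply: ge0_le_integral => //=.
  - by move=> t _; apply: integral_ge0 => w _; rewrite lee_fin.
  - pose G (z : R * T) := (F z.1 (shifted z.1 z.2))%:E.
    apply: (@measurable_fun_fubini_tonelli_F _ _ _ _ _ P G) => [|z].
      by apply/measurable_EFinP; exact: (measurableT_comp mF mshift2).
    by rewrite lee_fin.
  - apply/(measurable_restrictT _ _).1 => //; apply: measurable_funTS.
    pose G (z : R * T) := (`|h (sc (shifted z.1 z.2)) - z.1| `^ q)%:E.
    have mG : measurable_fun [set: R * T] G.
      by apply/measurable_EFinP; exact: (measurableT_comp mpow mshift2).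
    have G0 z : (0 <= G z)%E by rewrite lee_fin powR_ge0.
    have := @measurable_fun_fubini_tonelli_F _ _ _ _ _ P G mG G0.
    apply: eq_measurable_fun => t _; apply: eq_integral => w _.
    by rewrite /G /= scE.
  - move=> t _; rewrite patchE; case: ifPn => tAB.
      apply: ge0_le_integral => //.
      - by move=> w _; rewrite lee_fin.
      - apply/measurable_EFinP; apply: (measurableT_comp _ (mshift t)).
        exact: mslice.
      - apply/measurable_EFinP.
        have := measurableT_comp mpow (measurable_fun_pair (measurable_cst t) (mshift t)).
        apply: eq_measurable_fun => w _ /=; by rewrite scE.
      - by move=> w _; rewrite lee_fin /F scE ler_piMr ?powR_ge0.
    rewrite integral0_eq// => w _; rewrite /F !indicE.
    have [cJ|] := boolP (center (shifted t w) \in J); last by rewrite mul0r mulr0.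
    have [cI|] := boolP (b * (t - center (shifted t w)) \in I); last by rewrite !mulr0.
    exfalso; move: tAB; apply/negP; rewrite negbK.
    move: cJ cI; rewrite !inE /= !in_itv/= => /andP[c1 c2] /andP[d1 d2].
    have e1 : - L <= t - center (shifted t w).
      by rewrite /L -mulNr ler_pdivrMr// mulrC.
    have e2 : t - center (shifted t w) <= L by rewrite /L ler_pdivlMr// mulrC.
    have aux (x y l r z : R) : x + l <= z -> z <= y - l ->
        - l <= r - z -> r - z <= l -> x <= r <= y.
      by move=> *; apply/andP; split; lra.
    exact: (aux _ _ _ _ _ c1 c2 e1 e2).
rewrite shift_tonelli//.
have -> : B - A - 2 * (K / b) = u2 - u1 by rewrite /u1 /u2 /L; ring.
have mxiv := measurable_vec_of _ mxi.
have mJxi : measurable_fun [set: T]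
    (fun w => (\1_J (center (vec_of xi w)) * dens (vec_of xi w))%:E).
  by apply/measurable_EFinP; exact: (measurableT_comp mJc mxiv).
rewrite -integral_dens// -ge0_integralZl//.
apply: ge0_le_integral.
- exact: measurableT.
- by move=> w _; apply: mule_ge0.
- by apply: emeasurable_funM => //; exact: measurable_cst.
- pose G (z : R * T) := (F z.1 (vec_of xi z.2) *
    (dens (vec_of xi z.2) * pdf z.1 (vec_of xi z.2)))%:E.
  have mp : measurable_fun [set: R * T] (fun z => (z.1, vec_of xi z.2)).
    by apply: measurable_fun_pair => //; exact: (measurableT_comp mxiv).
  have mG : measurable_fun [set: R * T] G.
    apply/measurable_EFinP; apply: measurable_funM.
      exact: (measurableT_comp mF mp).
    apply: measurable_funM; last exact: (measurableT_comp mpdf mp).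
    by apply: (measurableT_comp mdens); exact: (measurableT_comp mxiv).
  have G0 z : (0 <= G z)%E by rewrite lee_fin mulr_ge0// mulr_ge0.
  exact: (@measurable_fun_fubini_tonelli_G _ _ _ _ _ leb G mG G0).
move=> w _; set x := vec_of xi w.
rewrite muleC.
have -> : (\int[leb]_t (F t x * (dens x * pdf t x))%:E =
    (\1_J (center x) * dens x)%:E *
    \int[leb]_t (`|h (sc x) - t| `^ q * (b * psi K (b * (t - center x))))%:E)%E.
  rewrite -(ge0_integralZl_real leb (\1_J (center x) * dens x)
    (fun t => `|h (sc x) - t| `^ q * (b * psi K (b * (t - center x))))).
  - by apply: eq_integral => t _; congr EFin; rewrite /F /pdf /psi -/I; ring.
  - apply: measurable_funM; first exact: measurable_powR_dist.
    apply: measurable_funM => //; apply: (measurableT_comp mpsi).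
    by apply: measurable_funM => //; exact: measurable_funB.
  - by move=> t; rewrite mulr_ge0 ?powR_ge0// mulr_ge0// ltW.
  - by rewrite mulr_ge0// indicE.
apply: lee_wpmul2l => //.
exact: ge0_integral_recentred_powR_min.
Qed.

End location_model.

(** * Uniform product priors *)

Section product_prior.
Context {R : realType} {p : nat} {lo hi : R}.
Hypothesis lohi : lo < hi.
Local Notation nu := (uniform_prob lohi).
Local Open Scope ereal_scope.
Implicit Types (F : p.-tuple R -> \bar R) (x : p.-tuple R) (l : seq 'I_p).

Definition set_coord x (i : 'I_p) (t : R) : p.-tuple R :=
  [tuple if j == i then t else tnth x j | j < p].

Definition avg (i : 'I_p) F x : \bar R := \int[nu]_t F (set_coord x i t).

(** The product prior is encoded by iterated one-dimensional integrals; coordinates outside [l] keep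
    their values from the argument. *)
Definition avgs l F : p.-tuple R -> \bar R := foldr avg F l.

Lemma set_coordC x i j t u : i != j ->
  set_coord (set_coord x i t) j u = set_coord (set_coord x j u) i t.
Proof.
move=> ij; apply: eq_from_tnth => k; rewrite !tnth_mktuple.
by case: (eqVneq k j) => // ->; rewrite eq_sym (negbTE ij).
Qed.

Lemma measurable_set_coord i :
  measurable_fun [set: p.-tuple R * R] (fun z => set_coord z.1 i z.2).
Proof.
apply/measurable_fun_tnthP => j.
rewrite (_ : _ \o _ = fun z => if j == i then z.2 else tnth z.1 j); last first.
  by apply/funext => z /=; rewrite tnth_mktuple.
case: (j == i); first exact: measurable_snd.
exact: (measurableT_comp (measurable_tnth j) measurable_fst).
Qed.

Lemma measurable_avg i F : measurable_fun [set: p.-tuple R] F ->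
  (forall x, 0 <= F x) -> measurable_fun [set: p.-tuple R] (avg i F).
Proof.
move=> mF F0; pose G (z : p.-tuple R * R) := F (set_coord z.1 i z.2).
apply: (@measurable_fun_fubini_tonelli_F _ _ _ _ _ nu G) => [|z]; last exact: F0.
exact: (measurableT_comp mF (measurable_set_coord i)).
Qed.

Lemma avg_ge0 i F : (forall x, 0 <= F x) -> forall x, 0 <= avg i F x.
Proof. by move=> F0 x; apply: integral_ge0. Qed.

Lemma measurable_avgs l F : measurable_fun [set: p.-tuple R] F ->
  (forall x, 0 <= F x) ->
  measurable_fun [set: p.-tuple R] (avgs l F) /\ (forall x, 0 <= avgs l F x).
Proof.
move=> mF F0; elim: l => //= k l [mA A0]; split; first exact: measurable_avg.
exact: avg_ge0.
Qed.

Lemma measurable_fun_set_coord F x i : measurable_fun [set: p.-tuple R] F ->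
  measurable_fun [set: R] (fun t => F (set_coord x i t)).
Proof.
move=> mF.
exact: (measurableT_comp mF
  (measurableT_comp (measurable_set_coord i) (pair1_measurable x))).
Qed.

Lemma avgC i j F : i != j -> measurable_fun [set: p.-tuple R] F ->
  (forall x, 0 <= F x) -> avg i (avg j F) = avg j (avg i F).
Proof.
move=> ij mF F0; apply/funext => x; rewrite /avg.
pose G (z : R * R) := F (set_coord (set_coord x i z.1) j z.2).
rewrite (@fubini_tonelli _ _ _ _ _ nu nu G) => [||z]; last exact: F0.
  by apply: eq_integral => u _; apply: eq_integral => t _; rewrite /G set_coordC.
have mH : measurable_fun [set: R * R] (fun z => (set_coord x i z.1, z.2)).
  apply: measurable_fun_pair; last exact: measurable_snd.
  exact: (measurableT_comp (measurableT_comp (measurable_set_coord i)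
    (pair1_measurable x)) measurable_fst).
exact: (measurableT_comp (measurableT_comp mF (measurable_set_coord j)) mH).
Qed.

Lemma avg_avgs i l F : i \notin l -> measurable_fun [set: p.-tuple R] F ->
  (forall x, 0 <= F x) -> avg i (avgs l F) = avgs l (avg i F).
Proof.
move=> + mF F0; elim: l => //= k l IH; rewrite inE negb_or => /andP[ik il].
have [mA A0] := measurable_avgs l F mF F0.
by rewrite avgC// IH.
Qed.

Lemma avg_cst_le i F (c : \bar R) : measurable_fun [set: p.-tuple R] F ->
  0 <= c -> (forall x, c <= F x) -> forall x, c <= avg i F x.
Proof.
move=> mF c0 cF x.
have <- : \int[nu]_t cst c t = c.
  rewrite integral_cst; last exact: measurableT.
  by rewrite -[RHS]mule1; congr (_ * _); exact: probability_setT.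
apply: ge0_le_integral.
- exact: measurableT.
- by [].
- exact: measurable_cst.
- exact: measurable_fun_set_coord.
- by move=> t _; exact: cF.
Qed.

Lemma avgs_cst_le l F (c : \bar R) : measurable_fun [set: p.-tuple R] F ->
  (forall x, 0 <= F x) -> 0 <= c -> (forall x, c <= F x) ->
  forall x, c <= avgs l F x.
Proof.
move=> mF F0 c0 cF; elim: l => //= k l IH.
by have [mA A0] := measurable_avgs l F mF F0; exact: avg_cst_le.
Qed.

(** When the induction reaches [i], its average commutes past the remaining ones and acts on [F]
    directly, where the bound is assumed. All other averages preserve a constant lower bound. *)
Lemma avgs_lb l i F (c : \bar R) : measurable_fun [set: p.-tuple R] F ->
  (forall x, 0 <= F x) -> 0 <= c -> uniq l -> i \in l ->
  (forall x, c <= avg i F x) -> forall x, c <= avgs l F x.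
Proof.
move=> mF F0 c0 + + cF; elim: l => //= k l IH /andP[kl ul].
have [mA A0] := measurable_avgs l F mF F0.
rewrite inE => /orP[/eqP ik|il].
  rewrite -ik avg_avgs//; last by rewrite ik.
  apply: avgs_cst_le => //; [exact: measurable_avg|exact: avg_ge0].
by apply: avg_cst_le => //; exact: IH.
Qed.

(** The prior charges only points with coordinates of [l] in [[lo, hi]] and the others as in [x].
    The base point [x] varies in the induction, since each integration overwrites one of its
    coordinates. *)
Lemma avgs_ub l F (C : \bar R) : measurable_fun [set: p.-tuple R] F ->
  (forall x, 0 <= F x) -> 0 <= C -> forall x,
  (forall y, (forall j, j \in l -> (lo <= tnth y j <= hi)%R) ->
    (forall j, j \notin l -> tnth y j = tnth x j) -> F y <= C) ->
  avgs l F x <= C.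
Proof.
move=> mF F0 C0; elim: l => [x /= FC|k l IH x FC /=]; first exact: FC.
have [mA A0] := measurable_avgs l F mF F0.
have AC t : (lo <= t <= hi)%R -> avgs l F (set_coord x k t) <= C.
  move=> tI; apply: IH => y yl ynl; apply: FC => j.
    rewrite inE; have [jl|jl] := boolP (j \in l); first by move=> _; exact: yl.
    by rewrite orbF => /eqP jk; rewrite ynl// tnth_mktuple jk eqxx.
  by rewrite inE negb_or => /andP[jk jl]; rewrite ynl// tnth_mktuple (negbTE jk).
rewrite /avg integral_uniform; last 2 first.
- exact: measurable_fun_set_coord.
- by move=> t; exact: A0.
have d0 : (0 < hi - lo)%R by rewrite subr_gt0.
apply: (@le_trans _ _ ((hi - lo)^-1%:E *
    \int[lebesgue_measure]_(t in `[lo, hi]) cst C t)).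
  apply: lee_wpmul2l; first by rewrite lee_fin invr_ge0 ltW.
  apply: ge0_le_integral.
  - exact: measurable_itv.
  - by move=> t _; exact: A0.
  - by apply: measurable_funTS; exact: measurable_fun_set_coord.
  - exact: measurable_cst.
  - by move=> t /=; rewrite in_itv/=; exact: AC.
rewrite integral_cst; last exact: measurable_itv.
rewrite /= lebesgue_measure_itv/= lte_fin lohi muleCA -EFinD -EFinM mulVf ?mule1//.
by rewrite gt_eqF.
Qed.

Lemma avgs_sum l (I : Type) (r : seq I) (F : I -> p.-tuple R -> \bar R) :
  (forall i, measurable_fun [set: p.-tuple R] (F i)) ->
  (forall i x, 0 <= F i x) -> forall x,
  avgs l (fun x => \sum_(i <- r) F i x) x = \sum_(i <- r) avgs l (F i) x.
Proof.
move=> mF F0; elim: l => //= k l IH x; rewrite /avg.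
rewrite -ge0_integral_sum; first by apply: eq_integral => t _; exact: IH.
- exact: measurableT.
- move=> i; apply: measurable_fun_set_coord.
  by have [] := measurable_avgs l (F i) (mF i) (F0 i).
- move=> i t _; by have [] := measurable_avgs l (F i) (mF i) (F0 i).
Qed.

End product_prior.

(** * The minimax lower bound *)

Section risk_bounds.
Context {R : realType} {d : measure_display} {T : measurableType d}.
Variables (P : probability T R) (n p : nat) (X : 'M[R]_(n, p)) (sigma : R).
Variables (xi : 'I_n -> T -> R) (q a : R).
Hypothesis sigma0 : 0 < sigma.
Hypothesis mxi : forall i, measurable_fun [set: T] (xi i).
Hypothesis xi_ind : mutually_independent P xi.
Hypothesis xi_law : forall i (A : set R), measurable A ->
  P (xi i @^-1` A) = normal_prob 0 1 A.
Hypotheses (q1 : 1 <= q) (a0 : 0 < a).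
Variable est : n.-tuple R -> p.-tuple R.
Hypothesis mest : measurable_fun [set: n.-tuple R] est.
Local Open Scope ereal_scope.

Definition coord_risk (i : 'I_p) (beta : p.-tuple R) : \bar R :=
  \int[P]_w (powR `|tnth (est (obs X sigma xi beta w)) i - tnth beta i| q)%:E.

(** The constant of the location model at window [K]; it tends to $\sigma_q^q$ as [K] grows. *)
Definition truncated_moment (K : R) : \bar R :=
  \int[lebesgue_measure]_x
    (`|x| `^ q * (\1_`[- K, K] x * normal_pdf 0 sigma x))%:E.

Let mloss i : measurable_fun [set: p.-tuple R * T]
  (fun z => (powR `|tnth (est (obs X sigma xi z.1 z.2)) i - tnth z.1 i| q)%:E).
Proof.
apply/measurable_EFinP; apply: (measurableT_comp (measurable_powR q)).
apply: measurableT_comp => //; apply: measurable_funB; last first.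
  exact: (measurableT_comp (measurable_tnth i) measurable_fst).
have mo : measurable_fun [set: p.-tuple R * T] (fun z => obs X sigma xi z.1 z.2).
  apply: (measurable_vec_of (fun k (z : p.-tuple R * T) =>
    (\sum_(j < p) X k j * tnth z.1 j) + sigma * xi k z.2)%R) => k.
  apply: measurable_funD.
    apply: measurable_sum => j; apply: measurable_funM => //.
    exact: (measurableT_comp (measurable_tnth j) measurable_fst).
  apply: measurable_funM => //; exact: (measurableT_comp (mxi k) measurable_snd).
exact: (measurableT_comp (measurable_tnth i) (measurableT_comp mest mo)).
Qed.

Lemma coord_risk_ge0 i beta : 0 <= coord_risk i beta.
Proof. by apply: integral_ge0 => w _; rewrite lee_fin powR_ge0. Qed.

Lemma measurable_coord_risk i :
  measurable_fun [set: p.-tuple R] (coord_risk i).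
Proof.
apply: (@measurable_fun_fubini_tonelli_F _ _ _ _ _ P _ (mloss i)) => z.
by rewrite lee_fin powR_ge0.
Qed.

Lemma risk_sum beta :
  risk P X sigma xi q est beta = \sum_(i < p) coord_risk i beta.
Proof.
rewrite /risk -ge0_integral_sum.
- by apply: eq_integral => w _; rewrite sumEFin.
- exact: measurableT.
- by move=> i; exact: (measurableT_comp (mloss i) (pair1_measurable beta)).
- by move=> i w _; rewrite lee_fin powR_ge0.
Qed.

Lemma coord_risk_le_risk i beta : coord_risk i beta <= risk P X sigma xi q est beta.
Proof.
rewrite risk_sum (bigD1 i)//= leeDl// sume_ge0// => j _.
exact: coord_risk_ge0.
Qed.

Lemma truncated_moment_ge0 K : 0 <= truncated_moment K.
Proof.
apply: integral_ge0 => x _.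
by rewrite lee_fin mulr_ge0 ?powR_ge0// indicE mulr_ge0// normal_pdf_ge0.
Qed.

Lemma sum_set_coord (k : 'I_n) (i : 'I_p) x t :
  (\sum_(j < p) X k j * tnth (set_coord x i t) j =
   X k i * t + \sum_(j < p | j != i) X k j * tnth x j)%R.
Proof.
rewrite (bigD1 i)//= tnth_mktuple eqxx; congr (_ + _)%R.
by apply: eq_bigr => j ji; rewrite tnth_mktuple (negbTE ji).
Qed.

(** With the other coordinates frozen, their contribution to the observation is a known offset.
    Adding it before applying [est] gives an estimator [h] in the location model on $[a, a+M]$;
    dividing by $M$ normalises the prior. *)
Lemma avg_coord_risk_lb (i : 'I_p) (M K : R) (hM : (a < a + M)%R) x :
  (0 < col_norm2 X i)%R -> (0 <= K)%R -> (2 * (K / col_norm2 X i) <= M)%R ->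
  ((col_norm2 X i `^ q)^-1)%:E * truncated_moment K *
    ((M - 2 * (K / col_norm2 X i)) / M)%:E <= avg hM i (coord_risk i) x.
Proof.
move=> b0 K0 KM; set b := col_norm2 X i in b0 KM *.
have M0 : (0 < M)%R by rewrite -(ltrD2l a) addr0.
have bE : (b ^+ 2 = \sum_(k < n) X k i ^+ 2)%R.
  by rewrite sqr_sqrtr// sumr_ge0// => k _; rewrite sqr_ge0.
pose add_rest (y : n.-tuple R) : n.-tuple R :=
  vec_of (fun k y => tnth y k + \sum_(j < p | j != i) X k j * tnth x j)%R y.
have madd : measurable_fun [set: n.-tuple R] add_rest.
  apply: measurable_vec_of => k; apply: measurable_funD => //.
  exact: measurable_tnth.
pose h y := tnth (est (add_rest y)) i.
have mh : measurable_fun [set: n.-tuple R] h.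
  exact: (measurableT_comp (measurable_tnth i) (measurableT_comp mest madd)).
have AB : (a + 2 * (K / b) <= a + M)%R by rewrite lerD2l.
have := bayes_risk_location P n xi mxi xi_ind xi_law sigma b (fun k => X k i)
  sigma0 b0 bE q a (a + M) K h q1 mh K0 AB.
rewrite -/(truncated_moment K) => H.
rewrite /avg integral_uniform; last 2 first.
- exact: measurable_fun_set_coord (measurable_coord_risk i).
- by move=> t; exact: coord_risk_ge0.
rewrite (_ : a + M - a = M)%R; last by ring.
have Mi0 : 0 <= M^-1%:E :> \bar R by rewrite lee_fin invr_ge0 ltW.
apply: (le_trans _ (lee_wpmul2l Mi0 _)); last first.
  apply: (le_trans H); rewrite le_eqVlt; apply/orP; left; apply/eqP.
  apply: eq_integral => t _.
  rewrite /coord_risk; apply: eq_integral => w _.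
  rewrite tnth_mktuple eqxx /h; congr ((`|tnth (est _) i - _| `^ _)%:E)%R.
  by apply: eq_from_tnth => k; rewrite !tnth_mktuple sum_set_coord addrAC.
rewrite (_ : a + M - a - _ = M - 2 * (K / b))%R; last by ring.
by rewrite muleCA -EFinM (mulrC M^-1)%R.
Qed.

Lemma Omega_set_coord0 s i t : (0 < s)%N -> (a <= t)%R ->
  Omega s a (set_coord [tuple 0%R | _ < p] i t).
Proof.
move=> s0 at_; split.
  apply: (@leq_trans #|[set i]%SET|); last by rewrite cards1.
  apply/subset_leq_card/fintype.subsetP => j; rewrite !inE /= !tnth_mktuple.
  by case: (eqVneq j i) => // _; rewrite eqxx.
move=> j; rewrite !tnth_mktuple; case: (eqVneq j i) => [_ _|_]; last by rewrite eqxx.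
by rewrite (le_trans at_)// ler_norm.
Qed.

(* The law of [Y] does not depend on [beta_i] here, so one estimate has to serve
   both [beta_i = a] and [beta_i = a + 2 K]. *)
Lemma sup_risk_zero_column s (i : 'I_p) : (0 < s)%N -> col_norm2 X i = 0%R ->
  ereal_sup [set risk P X sigma xi q est beta | beta in @Omega R p s a] = +oo.
Proof.
move=> s0 Xi0; set C := ereal_sup _.
have q0 : (0 < q)%R by apply: lt_le_trans q1.
have X0 k : X k i = 0%R.
  have /eqP : (\sum_(k < n) X k i ^+ 2 = 0)%R.
    move/eqP: Xi0; rewrite sqrtr_eq0 => le0; apply/le_anti; rewrite le0/=.
    by apply: sumr_ge0 => j _; exact: sqr_ge0.
  rewrite psumr_eq0; last by move=> j _; exact: sqr_ge0.
  by move=> /allP/(_ k (mem_index_enum k)); rewrite sqrf_eq0 => /eqP.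
pose x0 : p.-tuple R := [tuple 0%R | _ < p].
have obsE t w : obs X sigma xi (set_coord x0 i t) w = obs X sigma xi x0 w.
  apply: eq_from_tnth => k; rewrite !tnth_mktuple; congr (_ + _)%R.
  apply: eq_bigr => j _; rewrite !tnth_mktuple.
  by case: (eqVneq j i) => // ->; rewrite X0 !mul0r.
have CG t : (a <= t)%R -> coord_risk i (set_coord x0 i t) <= C.
  move=> at_; apply: (le_trans (coord_risk_le_risk i _)).
  by apply: ereal_sup_ubound; exists (set_coord x0 i t) => //; exact: Omega_set_coord0.
(* If both risks were below $K^q$, so would be their average; but the two losses always add up to at
   least $2K^q$. *)
have CK K : (0 <= K)%R -> (K `^ q)%:E <= C.
  move=> K0; rewrite leNgt; apply/negP => CK.
  have C1 := le_lt_trans (CG a (lexx _)) CK.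
  have aK : (a <= a + 2 * K)%R by rewrite lerDl mulr_ge0.
  have C2 := le_lt_trans (CG _ aK) CK.
  have := lteD C1 C2; apply/negP; rewrite -leNgt -EFinD.
  have m1 t : measurable_fun [set: T] (fun w => (powR
    `|tnth (est (obs X sigma xi (set_coord x0 i t) w)) i
      - tnth (set_coord x0 i t) i| q)%:E).
    exact: (measurableT_comp (mloss i) (pair1_measurable _)).
  have f0 (y z : R) : 0 <= (powR `|y - z| q)%:E by rewrite lee_fin powR_ge0.
  rewrite /coord_risk -ge0_integralD; first last.
  - exact: m1.
  - by move=> w _; exact: f0.
  - exact: m1.
  - by move=> w _; exact: f0.
  - exact: measurableT.
  have <- : \int[P]_w cst (K `^ q + K `^ q)%:E w = (K `^ q + K `^ q)%:E.
    rewrite integral_cst; last exact: measurableT.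
    by rewrite -[RHS]mule1; congr (_ * _); exact: probability_setT.
  apply: ge0_le_integral.
  - exact: measurableT.
  - by move=> w _; rewrite lee_fin addr_ge0// powR_ge0.
  - exact: measurable_cst.
  - by apply: emeasurable_funD; exact: m1.
  - move=> w _; rewrite !obsE !tnth_mktuple eqxx -EFinD lee_fin.
    set g := tnth _ i.
    (* The midpoint is chosen so that its two neighbours at distance $K$ are the errors $g-(a+2K)$
       and $g-a$. *)
    have := powR_abs_midpoint q (g - a - K)%R K q1.
    rewrite (ger0_norm K0) mulr_natl mulr2n.
    rewrite (_ : g - a - K - K = g - (a + 2 * K))%R; last by ring.
    rewrite (_ : g - a - K + K = g - a)%R; last by ring.
    by move/le_trans; apply; rewrite addrC.
case CE : C => [r|//|].
(* For a finite supremum $r$, this $K$ has $K^q = |r|+1 > r$. *)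
- have := CK ((`|r| + 1) `^ q^-1)%R (powR_ge0 _ _).
  rewrite -powRrM mulVf ?gt_eqF// powRr1 ?addr_ge0// CE lee_fin leNgt.
  by rewrite (le_lt_trans (ler_norm r))// ltrDl.
- by have := CK 0%R (lexx _); rewrite CE leNgt ltNyr.
Qed.

(** The factor [r] absorbs the boundary loss: a prior interval that is long enough makes $(M -
    2K/\|X_i\|_2)/M \ge r$ for all $i$ in [S] at once. *)
Lemma sup_risk_truncated_lb (S : {set 'I_p}) (K r : R) : (0 <= K)%R ->
  (forall i, i \in S -> (0 < col_norm2 X i)%R) -> (0 < r < 1)%R ->
  r%:E * (truncated_moment K * (\sum_(i in S) (col_norm2 X i `^ q)^-1)%:E) <=
  ereal_sup [set risk P X sigma xi q est beta | beta in @Omega R p #|S| a].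
Proof.
move=> K0 bS /andP[r0 r1]; set C := ereal_sup _.
(* Dominates every window width $2K/\|X_i\|_2$; the summand $1$ keeps it positive even when [S] is
   empty or [K] is zero. *)
pose L : R := (1 + \sum_(i in S) 2 * (K / col_norm2 X i))%R.
have Li0 i : i \in S -> (0 <= 2 * (K / col_norm2 X i))%R.
  by move=> iS; rewrite mulr_ge0// divr_ge0// ltW// bS.
have L0 : (0 < L)%R by rewrite ltr_pwDl// sumr_ge0.
have r1' : (0 < 1 - r)%R by rewrite subr_gt0.
(* Solves $M - L = rM$. *)
pose M : R := (L / (1 - r))%R.
have M0 : (0 < M)%R by rewrite divr_gt0.
have hM : (a < a + M)%R by rewrite ltrDl.
have LM : (L = M * (1 - r))%R by rewrite /M divfK// gt_eqF.
have LiL i : i \in S -> (2 * (K / col_norm2 X i) <= L)%R.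
  move=> iS; rewrite /L (bigD1 i)//= addrCA lerDl addr_ge0//.
  by apply: sumr_ge0 => j /andP[jS _]; exact: Li0.
pose x0 : p.-tuple R := [tuple 0%R | _ < p].
pose F x := \sum_(i <- enum S) coord_risk i x.
have mF : measurable_fun [set: p.-tuple R] F.
  by apply: emeasurable_sum => i; exact: measurable_coord_risk.
have F0 x : 0 <= F x by apply: sume_ge0 => i _; exact: coord_risk_ge0.
have OmegaS y : (forall j, j \in S -> (a <= tnth y j)%R) ->
    (forall j, j \notin S -> tnth y j = 0%R) -> Omega #|S| a y.
  move=> yS ynS; split.
    apply/subset_leq_card/fintype.subsetP => j; rewrite inE /= => yj.
    by apply: contraLR yj => jS; rewrite negbK ynS.
  move=> j yj; have [jS|jS] := boolP (j \in S); last by rewrite ynS// eqxx in yj.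
  by rewrite (le_trans (yS _ jS))// ler_norm.
have C0 : 0 <= C.
  pose y : p.-tuple R := [tuple if j \in S then a else 0%R | j < p].
  apply: (@le_trans _ _ (risk P X sigma xi q est y)).
    by rewrite risk_sum; apply: sume_ge0 => i _; exact: coord_risk_ge0.
  apply: ereal_sup_ubound; exists y => //; apply: OmegaS => j jS.
    by rewrite tnth_mktuple jS.
  by rewrite tnth_mktuple (negbTE jS).
have ub : avgs hM (enum S) F x0 <= C.
  apply: avgs_ub => // y yS ynS.
  (* The coordinates outside [S] contribute nonnegative risks, which are dropped. *)
  apply: (@le_trans _ _ (risk P X sigma xi q est y)).
    rewrite risk_sum /F big_enum/= [leRHS](bigID (mem S))/= leeDl//.
    by apply: sume_ge0 => i _; exact: coord_risk_ge0.
  apply: ereal_sup_ubound; exists y => //; apply: OmegaS => j jS.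
    by have /andP[] : (a <= tnth y j <= a + M)%R by apply: yS; rewrite mem_enum.
  by rewrite ynS ?mem_enum// tnth_mktuple.
apply: le_trans ub; rewrite /F avgs_sum; last 2 first.
- exact: measurable_coord_risk.
- exact: coord_risk_ge0.
rewrite -sumEFin ge0_sume_distrr; last first.
  by move=> i _; rewrite lee_fin invr_ge0 powR_ge0.
rewrite ge0_sume_distrr; last first.
  move=> i _; rewrite mule_ge0 ?truncated_moment_ge0//.
  by rewrite lee_fin invr_ge0 powR_ge0.
rewrite -big_enum/= [leLHS]big_seq [leRHS]big_seq; apply: lee_sum => i.
rewrite mem_enum => iS; have b0 := bS _ iS.
have c0 : 0 <= ((col_norm2 X i `^ q)^-1)%:E * truncated_moment K.
  by rewrite mule_ge0 ?truncated_moment_ge0// lee_fin invr_ge0 powR_ge0.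
apply: (@avgs_lb _ _ _ _ hM (enum S) i).
- exact: measurable_coord_risk.
- exact: coord_risk_ge0.
- by rewrite mule_ge0 ?lee_fin ?(ltW r0)// muleC.
- exact: enum_uniq.
- by rewrite mem_enum.
move=> x; apply: le_trans (avg_coord_risk_lb i M K hM x b0 K0 _); last first.
  by rewrite (le_trans (LiL _ iS))// LM ler_piMr ?(ltW M0)// gerBl ltW.
rewrite muleC [X in X * _]muleC; apply: lee_wpmul2l => //.
rewrite lee_fin ler_pdivlMr// -(lerD2r (2 * (K / col_norm2 X i))) subrK.
apply: (@le_trans _ _ (r * M + L)%R); first by rewrite lerD2l LiL.
by rewrite LM le_eqVlt; apply/orP; left; apply/eqP; ring.
Qed.

(** Monotone convergence along the intervals $[-k,k]$, after writing the normal law through its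
    density. *)
Lemma truncated_moment_cvg :
  truncated_moment k%:R @[k --> \oo] --> sigma_q_q sigma q.
Proof.
pose g (x : R) := (`|x| `^ q * normal_pdf 0 sigma x)%:E.
have mpow : measurable_fun [set: R] (fun x : R => `|x| `^ q)%R.
  by apply: (measurableT_comp (measurable_powR q)).
have mg : measurable_fun [set: R] g.
  apply/measurable_EFinP; apply: measurable_funM => //.
  exact: measurable_normal_pdf.
have g0 x : 0 <= g x by rewrite lee_fin mulr_ge0 ?powR_ge0 ?normal_pdf_ge0.
have -> : sigma_q_q sigma q = \int[lebesgue_measure]_x g x.
  rewrite /sigma_q_q
    (@ge0_integral_density _ _ _ _ lebesgue_measure (normal_pdf 0 sigma)).
  - by apply: eq_integral => x _; rewrite -EFinM.
  - exact: measurable_normal_pdf.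
  - exact: normal_pdf_ge0.
  - by [].
  - exact/measurable_EFinP.
  - by move=> x; rewrite lee_fin powR_ge0.
pose F k := `[(- k%:R)%R, (k%:R : R)]%classic : set R.
have -> : (fun k => truncated_moment k%:R) =
    (fun k => \int[lebesgue_measure]_(x in F k) g x).
  apply/funext => k; rewrite [RHS]integral_mkcond; apply: eq_integral => x _.
  rewrite patchE indicE /F; case: ifPn => _; first by rewrite mul1r.
  by rewrite mul0r mulr0.
have <- : \bigcup_k F k = [set: R] by exact: bigcup_itvT.
apply: ge0_nondecreasing_set_cvg_integral.
- move=> k l kl; apply/subsetPset => x; rewrite /F/= !in_itv/= -!ler_norml.
  by move/le_trans; apply; rewrite ler_nat.
- by move=> k; exact: measurable_itv.
- by move=> k; exact: measurable_funTS.
- by move=> k x _; exact: g0.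
Qed.

Lemma sigma_q_q_ge0 : 0 <= sigma_q_q sigma q.
Proof. by apply: integral_ge0 => x _; rewrite lee_fin powR_ge0. Qed.

(** A zero column in [S] makes the supremum infinite. Otherwise the truncated bound is passed to the
    limit, first $r \to 1$ and then $K \to \infty$. *)
Lemma sup_risk_lb (S : {set 'I_p}) :
  sigma_q_q sigma q * \sum_(i in S) ((powR (col_norm2 X i) q)%:E)^-1 <=
  ereal_sup [set risk P X sigma xi q est beta | beta in @Omega R p #|S| a].
Proof.
have b_ge0 i : (0 <= col_norm2 X i)%R by exact: sqrtr_ge0.
have [/existsP[i /andP[iS /eqP Xi0]]|noz] :=
    boolP [exists i, (i \in S) && (col_norm2 X i == 0%R)].
  by rewrite (@sup_risk_zero_column _ i) ?leey// card_gt0; apply/set0Pn; exists i.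
have bS i : i \in S -> (0 < col_norm2 X i)%R.
  move=> iS; rewrite lt_neqAle b_ge0 andbT eq_sym; apply: contra noz => bi0.
  by apply/existsP; exists i; rewrite iS.
rewrite (eq_bigr (fun i => ((col_norm2 X i `^ q)^-1)%:E)); last first.
  by move=> i iS; rewrite inver gt_eqF// powR_gt0// bS.
rewrite sumEFin; set kappa := (\sum_(i in S) _)%R; set C := ereal_sup _.
have k0 : (0 <= kappa)%R by apply: sumr_ge0 => i _; rewrite invr_ge0 powR_ge0.
have H (k : nat) : truncated_moment k%:R * kappa%:E <= C.
  (* A bound by [C] for every multiple with $0 < r < 1$ gives the bound itself. *)
  apply/lee_mul01Pr; first by rewrite mule_ge0 ?truncated_moment_ge0 ?lee_fin.
  by move=> r r01; exact: sup_risk_truncated_lb.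
have cv : truncated_moment k%:R * kappa%:E @[k --> \oo] -->
    sigma_q_q sigma q * kappa%:E.
  by apply: cvgeZr => //; exact: truncated_moment_cvg.
rewrite -(cvg_lim _ cv)//; apply: lime_le; first by apply/cvg_ex; eexists; exact: cv.
by near=> k; exact: H.
Unshelve. all: by end_near.
Qed.

End risk_bounds.

Theorem theorem3 (R : realType) (d : measure_display) (T : measurableType d)
  (P : probability T R) (n p : nat) (X : 'M[R]_(n, p)) (sigma : R)
  (xi : 'I_n -> T -> R)
  (hsigma : 0 < sigma)
  (hxi_meas : forall i, measurable_fun [set: T] (xi i))
  (hxi_ind : mutually_independent P xi)
  (hxi_law : forall i (A : set R), measurable A ->
     P (xi i @^-1` A) = normal_prob 0 1 A)
  (a q : R) (s : nat)
  (ha : 0 < a) (hq : 1 <= q) (hs : (s < p)%N) :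
  (ereal_inf [set ereal_sup [set risk P X sigma xi q betahat beta
                            | beta in @Omega R p s a]
             | betahat in [set f : n.-tuple R -> p.-tuple R
                            | measurable_fun [set: n.-tuple R] f]]
   >= sigma_q_q sigma q * col_bound s X q)%E.
Proof.
apply/ereal_infP => _ [est mest <-].
set C := ereal_sup _.
(* The zero vector lies in [Omega]; nonnegativity of [C] covers the product $0 \cdot (-\infty) = 0$
   below. *)
have C0 : (0 <= C)%E.
  pose x0 : p.-tuple R := [tuple 0 | _ < p].
  apply: (@le_trans _ _ (risk P X sigma xi q est x0)).
    by apply: integral_ge0 => w _; rewrite lee_fin sumr_ge0// => i _; exact: powR_ge0.
  apply: ereal_sup_ubound; exists x0 => //; split.
    rewrite eq_card0// => i; apply/negbTE/negP.
    by rewrite inE /= tnth_mktuple eqxx.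
  by move=> i; rewrite tnth_mktuple eqxx.
rewrite /col_bound.
(* The bound holds for the default value $-\infty$ of the maximum, survives binary maxima, and holds
   for each admissible [S]. *)
apply: (big_ind (fun z => (sigma_q_q sigma q * z <= C)%E)).
- have [s0|s0] := leP (sigma_q_q sigma q) 0%E.
    have -> : sigma_q_q sigma q = 0%E by apply/le_anti; rewrite s0 sigma_q_q_ge0.
    by rewrite mul0e.
  by rewrite gt0_muleNy// leNye.
- by move=> y z yC zC; rewrite /maxe; case: ifP.
- by move=> S /eqP Ss; rewrite /C -Ss; exact: sup_risk_lb.
Qed.
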